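(* Let $M$ be a matroid on a finite ground set $E$. The augmented Bergman complex $\Delta_M$ is shellable, via two families of shellings: (i) one family that shells the facets of the subcomplex $\mathrm{Cone}(\underline{\Delta}_M)$ first, and the facets of the subcomplex $\mathcal{I}(M)$ last; (ii) one family that shells the facets of the subcomplex $\mathcal{I}(M)$ first, and the facets of the subcomplex $\mathrm{Cone}(\underline{\Delta}_M)$ last.
   Context: Let $M$ be a matroid on a finite set $E$, with independent sets $\mathcal{I}(M)$, flats $\mathcal{F}(M)$ partially ordered by inclusion, rank $r(M)$, and closure $A\mapsto\overline{A}$ (the smallest flat containing $A$). The collection $\mathcal{I}(M)$ is regarded as an abstract simplicial complex. For a poset $P$, the order complex $\Delta P$ is the simplicial complex on vertex set $P$ whose simplices are the totally ordered subsets of $P$. The Bergman complex is $\underline{\Delta}_M:=\Delta(\mathcal{F}(M)\setminus\{\overline{\varnothing},E\})$, and the cone over it is $\mathrm{Cone}(\underline{\Delta}_M):=\Delta(\mathcal{F}(M)\setminus\{E\})$. The augmented Bergman complex $\Delta_M$ is the abstract simplicial complex on vertex set $\{y_i: i\in E\}\sqcup\{x_F: F\in\mathcal{F}(M)\setminus\{E\}\}$ whose simplices are the subsets $\{y_i\}_{i\in I}\cup\{x_{F_1},\ldots,x_{F_\ell}\}$ for which $I\in\mathcal{I}(M)$, $\ell\ge 0$, and the proper flats $F_j$ satisfy $I\subseteq F_1\subsetneq F_2\subsetneq\cdots\subsetneq F_\ell\ (\subsetneq E)$. It is pure of dimension $r(M)-1$, and it contains as full-dimensional subcomplexes both $\mathcal{I}(M)$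 (the simplices with $\ell=0$) and $\mathrm{Cone}(\underline{\Delta}_M)$ (the simplices with $I=\varnothing$). A facet is an inclusion-maximal simplex; a complex is pure if all its facets have the same cardinality. A total order $\prec$ on the facets of a pure simplicial complex is a shelling order (a shelling) if for all facets $\phi\prec\phi'$ there exists a facet $\phi''\prec\phi'$ such that $\phi\cap\phi'\subseteq\phi''\cap\phi'$ and $\#(\phi''\cap\phi')=\#\phi'-1$. The complex is shellable if it has a shelling order. *)

(* Defs.v *)
From HB Require Import structures.
From mathcomp Require Import all_boot all_order.

Set Implicit Arguments.
Unset Strict Implicit.
Unset Printing Implicit Defensive.

Import Order.TTheory.

(* Elements of V need not be vertices of the complex: [set v] may fail to be a
   simplex (as happens below for the loops of a matroid). *)
Record complex (V : finType) := Complex {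
  simplices :> {set {set V}};
  complex0 : set0 \in simplices;
  complexS : forall S T : {set V}, T \subset S -> S \in simplices ->
    T \in simplices }.

Definition facets (V : finType) (K : complex V) : {set {set V}} :=
  [set S | maxset (mem K) S].

Definition pure (V : finType) (K : complex V) : Prop :=
  {in facets K &, forall S T : {set V}, #|S| = #|T|}.

Definition strict_total_order_on (T : finType) (A : {set T}) (lt : rel T) :
    Prop :=
  [/\ {in A, irreflexive lt},
      {in A & &, transitive lt} &
      {in A &, forall x y, x != y -> lt x y || lt y x}].

Definition is_shelling (V : finType) (K : complex V) (lt : rel {set V}) : Prop :=
  [/\ pure K,
      strict_total_order_on (facets K) lt &
      {in facets K &, forall phi phi', lt phi phi' ->
        exists phi'', [/\ phi'' \in facets K, lt phi'' phi',
          phi :&: phi' \subset phi'' :&: phi' &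
          #|phi'' :&: phi'| = #|phi'|.-1]}].

Definition shellable (V : finType) (K : complex V) : Prop :=
  exists lt, is_shelling K lt.

(* In the next two definitions L is meant to be a subcomplex of K all of whose
   facets are facets of K. *)
Definition facets_first (V : finType) (K L : complex V) (lt : rel {set V}) :
    Prop :=
  {in facets L & facets K :\: facets L, forall phi phi', lt phi phi'}.

Definition facets_last (V : finType) (K L : complex V) (lt : rel {set V}) :
    Prop :=
  {in facets K :\: facets L & facets L, forall phi phi', lt phi phi'}.

Section ImageComplex.
Variables (V W : finType) (f : V -> W) (K : complex V).

Definition image_simplices : {set {set W}} := [set f @: (S : {set V}) | S in K].

Lemma image_simplices0 : set0 \in image_simplices.
Proof. by apply/imsetP; exists set0; rewrite ?complex0 ?imset0. Qed.

Lemma image_simplicesS (S T : {set W}) :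
  T \subset S -> S \in image_simplices -> T \in image_simplices.
Proof.
move=> TS /imsetP[A AK defS]; apply/imsetP; exists (A :&: f @^-1: T).
  exact: complexS (subsetIl _ _) AK.
apply/setP => w; apply/idP/imsetP => [wT | [v]]; last first.
  by rewrite !inE => /andP[_ fvT] ->.
have := subsetP TS w wT; rewrite defS => /imsetP[v vA wE].
by exists v => //; rewrite !inE vA -wE.
Qed.

Definition image_complex : complex W :=
  Complex image_simplices0 image_simplicesS.

End ImageComplex.

Section OrderComplex.
Context {d : Order.disp_t} (P : finPOrderType d).

Definition chains : {set {set P}} :=
  [set C : {set P} | [forall x in C, forall y in C, (x >=< y)%O]].

Lemma chains0 : set0 \in chains.
Proof. by rewrite inE; apply/forall_inP => x; rewrite inE. Qed.

Lemma chainsS (S T : {set P}) : T \subset S -> S \in chains -> T \in chains.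
Proof.
move=> /subsetP TS; rewrite !inE => /forall_inP chS.
apply/forall_inP => x /TS xS; apply/forall_inP => y /TS yS.
exact: (forall_inP (chS x xS)).
Qed.

Definition order_complex : complex P := Complex chains0 chainsS.

End OrderComplex.

Record matroid (E : finType) := Matroid {
  indep : complex E;
  indep_augment : forall I J : {set E}, I \in indep -> J \in indep ->
    #|I| < #|J| -> exists2 e, e \in J :\: I & e |: I \in indep }.

Section Flats.
Variables (E : finType) (M : matroid E).

Definition rank (A : {set E}) : nat :=
  \max_(I in indep M | I \subset A) #|I|.

Definition flat (F : {set E}) : bool :=
  [forall e, (e \notin F) ==> (rank F < rank (e |: F))].

Record proper_flat := ProperFlat {
  flat_set :> {set E};
  _ : flat flat_set && (flat_set != [set: E]) }.

HB.instance Definition _ := [isSub for flat_set].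
HB.instance Definition _ := [Finite of proper_flat by <:].

Definition proper_flat_le : rel proper_flat :=
  fun F G => (F : {set E}) \subset (G : {set E}).

Lemma proper_flat_le_refl : reflexive proper_flat_le.
Proof. by move=> F; exact: subxx. Qed.

Lemma proper_flat_le_anti : antisymmetric proper_flat_le.
Proof. by move=> F G FG; apply/val_inj/eqP; rewrite eqEsubset. Qed.

Lemma proper_flat_le_trans : transitive proper_flat_le.
Proof. by move=> G F H; exact: subset_trans. Qed.

Fact proper_flat_display : Order.disp_t. Proof. exact: Order.Disp tt tt. Qed.

HB.instance Definition _ := Order.Le_isPOrder.Build proper_flat_display
  proper_flat proper_flat_le_refl proper_flat_le_anti proper_flat_le_trans.

Lemma proper_flat_leE (F G : proper_flat) :
  (F <= G)%O = ((F : {set E}) \subset (G : {set E})).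
Proof. by []. Qed.

(* The order complex of all flats other than E; its apex is the closure of the
   empty set. *)
Definition cone_bergman : complex proper_flat := order_complex proper_flat.

(* inl i is the vertex y_i and inr F is the vertex x_F. *)
Definition aug_vertex : finType := (E + proper_flat)%type.

Definition y_part (S : {set aug_vertex}) : {set E} := [set i | inl i \in S].

Definition x_part (S : {set aug_vertex}) : {set proper_flat} :=
  [set F | inr F \in S].

Definition aug_simplices : {set {set aug_vertex}} :=
  [set S : {set aug_vertex} |
    [&& y_part S \in indep M, x_part S \in cone_bergman &
        [forall F in x_part S, y_part S \subset (F : {set E})]]].

Lemma y_partS (S T : {set aug_vertex}) :
  T \subset S -> y_part T \subset y_part S.
Proof. by move=> /subsetP TS; apply/subsetP => i; rewrite !inE => /TS. Qed.

Lemma x_partS (S T : {set aug_vertex}) :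
  T \subset S -> x_part T \subset x_part S.
Proof. by move=> /subsetP TS; apply/subsetP => F; rewrite !inE => /TS. Qed.

Lemma aug_simplices0 : set0 \in aug_simplices.
Proof.
have y0 : y_part set0 = set0 by apply/setP => i; rewrite !inE.
have x0 : x_part set0 = set0 by apply/setP => F; rewrite !inE.
rewrite inE y0 x0 !complex0 /=; apply/forall_inP => F; rewrite inE //.
Qed.

Lemma aug_simplicesS (S T : {set aug_vertex}) :
  T \subset S -> S \in aug_simplices -> T \in aug_simplices.
Proof.
move=> TS; rewrite [_ \in _]inE => /and3P[yS xS /forall_inP yxS].
rewrite inE (complexS (y_partS TS) yS) (complexS (x_partS TS) xS) /=.
apply/forall_inP => F /(subsetP (x_partS TS)) /yxS.
exact: subset_trans (y_partS TS).
Qed.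

Definition augmented_bergman : complex aug_vertex :=
  Complex aug_simplices0 aug_simplicesS.

Definition aug_indep : complex aug_vertex :=
  image_complex (inl : E -> aug_vertex) (indep M).

Definition aug_cone : complex aug_vertex :=
  image_complex (inr : proper_flat -> aug_vertex) cone_bergman.

Lemma aug_indepE (S : {set aug_vertex}) :
  (S \in aug_indep) = (S \in augmented_bergman) && (x_part S == set0).
Proof.
apply/imsetP/andP => [[I IM ->]|[]].
  have x0 : x_part [set inl i | i in I] = set0.
    by apply/setP => F; rewrite !inE; apply/imsetP => -[].
  have yI : y_part [set inl i | i in I] = I.
    by apply/setP => i; rewrite inE mem_imset //; apply: inl_inj.
  rewrite inE x0 yI IM complex0 eqxx; split=> //=.
  by apply/forall_inP => F; rewrite inE.
rewrite inE => /and3P[yS _ _] /eqP/setP x0; exists (y_part S) => //.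
apply/setP => -[i|F]; first by rewrite mem_imset ?inE //; apply: inl_inj.
have := x0 F; rewrite !inE => ->; apply/esym/negbTE/negP.
by case/imsetP.
Qed.

Lemma aug_coneE (S : {set aug_vertex}) :
  (S \in aug_cone) = (S \in augmented_bergman) && (y_part S == set0).
Proof.
apply/imsetP/andP => [[C CM ->]|[]].
  have y0 : y_part [set inr F | F in C] = set0.
    by apply/setP => i; rewrite !inE; apply/imsetP => -[].
  have xC : x_part [set inr F | F in C] = C.
    by apply/setP => F; rewrite inE mem_imset //; apply: inr_inj.
  rewrite inE xC y0 CM complex0 eqxx; split=> //=.
  by apply/forall_inP => F _; apply: sub0set.
rewrite inE => /and3P[_ xS _] /eqP/setP y0; exists (x_part S) => //.
apply/setP => -[i|F]; last by rewrite mem_imset ?inE //; apply: inr_inj.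
have := y0 i; rewrite !inE => ->; apply/esym/negbTE/negP.
by case/imsetP.
Qed.

End Flats.

(* Main.v *)
(* A facet is a pair of an independent set I of size k and a flag
   F_k = cl I < F_(k+1) < ... < F_(r-1) of flats with rank F_j = j.  Facets are
   compared by k (increasing for (i), decreasing for (ii)), then by I
   lexicographically, then by the flag, level by level lexicographically.  Given
   (I, F) before (I', F'), a vertex of the latter missing in the former is
   exchanged so as to obtain an earlier facet:
   - in (i), if I' contains i not in I, trade y_i for x_(cl (I' - i));
   - in (ii), if cl I' is not in F, trade x_(cl I') for y_e with e in the next
     flat of F';
   - otherwise k = k' and cl I = cl I', and the lexicographic shelling of the
     bases of the flat cl I or of the flags above it provides the exchange. *)
Require Import Defs.
From mathcomp Require Import all_boot all_order.

Set Implicit Arguments.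
Unset Strict Implicit.
Unset Printing Implicit Defensive.

Import Order.TTheory.

Lemma lexi_pair_lt (d1 d2 : Order.disp_t) (T1 : orderType d1)
    (T2 : orderType d2) (x y : T1 *l T2) :
  (x < y)%O = (x.1 < y.1)%O || (x.1 == y.1) && (x.2 < y.2)%O.
Proof. by rewrite ltEprodlexi; case: (ltgtP x.1 y.1). Qed.

(** * Lexicographic order on finite sets *)

Section SetOrder.
Variable E : finType.
Implicit Types A B : {set E}.

(* Entries are \notin rather than \in because false < true: the set holding the
   least element on which two sets differ comes first. *)
Definition set_key A : #|E|.-tuplelexi bool :=
  [tuple enum_val i \notin A | i < #|E|].

Lemma set_key_inj : injective set_key.
Proof.
move=> A B /(congr1 (fun t : #|E|.-tuple bool => tnth t)) eqAB.
apply/setP => e; have := congr1 (fun f => f (enum_rank e)) eqAB.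
by rewrite !tnth_mktuple enum_rankK => /negb_inj.
Qed.

Lemma set_key_ltP A B :
  reflect (exists e, [/\ e \in A, e \notin B &
             forall b, enum_rank b < enum_rank e -> (b \in A) = (b \in B)])
          (set_key A < set_key B)%O.
Proof.
apply: (iffP ltxi_tuplePlt) => [[k eqk ltk]|[e [eA eB eqe]]].
  exists (enum_val k); move: ltk; rewrite !tnth_mktuple.
  case: (enum_val k \in A) => //; case: (enum_val k \in B) => // _.
  split=> // b; rewrite enum_valK => /eqk.
  by rewrite !tnth_mktuple enum_rankK => /negb_inj.
exists (enum_rank e) => [i lt_ie|]; last first.
  by rewrite !tnth_mktuple enum_rankK eA eB.
by rewrite !tnth_mktuple eqe // enum_valK.
Qed.

End SetOrder.

(** * Shellings from exchanges of one vertex *)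

Section Shelling.
Variables (V : finType) (K : complex V).

(** By purity [U] has as many vertices as [T]; containing [T :\ v] and differing from [T], it misses
    [v]. So [U :&: T] is exactly [T :\ v], which contains [S :&: T] because [v] is outside [S]. *)
Lemma exchange_shelling (lt : rel {set V}) :
  pure K -> strict_total_order_on (facets K) lt ->
  {in facets K &, forall S T, lt S T -> exists v U,
     [/\ v \in T :\: S, U \in facets K, lt U T & T :\ v \subset U]} ->
  is_shelling K lt.
Proof.
move=> pureK ltK exch; split=> // S T SK TK /(exch _ _ SK TK).
case=> v [U [/setDP[vT vS] UK ltUT sTU]]; exists U; have [irr _ _] := ltK.
have neqUT : U != T by apply: contraTneq ltUT => ->; rewrite irr.
have vU : v \notin U.
  apply: contra neqUT => vU; rewrite eq_sym eqEcard (pureK U T) // leqnn andbT.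
  by rewrite -(setD1K vT) subUset sub1set vU.
suff -> : U :&: T = T :\ v.
  split=> //; last by rewrite (cardsD1 v T) vT.
  apply/subsetP => u; rewrite !inE => /andP[uS ->]; rewrite andbT.
  by apply: contraNneq vS => <-.
apply/setP => u; rewrite !inE; apply/andP/andP => [[uU uT]|[uv uT]].
  by split=> //; apply: contraNneq vU => <-.
by split=> //; apply: (subsetP sTU); rewrite !inE uv.
Qed.

End Shelling.

(** * Rank and closure *)

Section Closure.
Variables (E : finType) (M : matroid E).
Implicit Types A B F G I J : {set E}.
Local Notation r := (rank M).

Lemma setU1_id (e : E) A : e \in A -> e |: A = A.
Proof. by move=> eA; apply/setUidPr; rewrite sub1set. Qed.

Lemma indep_leq_rank I A : I \in indep M -> I \subset A -> #|I| <= r A.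
Proof.
move=> IM sIA; rewrite /rank.
by apply: (@leq_bigmax_cond _ _ (fun I : {set E} => #|I|)); rewrite IM.
Qed.

Lemma indep_extend J A : J \in indep M -> J \subset A ->
  exists I, [/\ J \subset I, I \in indep M, I \subset A & #|I| = r A].
Proof.
move=> JM sJA; pose P I := [&& J \subset I, I \in indep M & I \subset A].
have PJ : P J by rewrite /P subxx JM.
case: (@arg_maxnP _ J P (fun I => #|I|) PJ) => I /and3P[sJI IM sIA] maxI.
exists I; split=> //; apply/eqP; rewrite eqn_leq indep_leq_rank //=.
apply/bigmax_leqP => B /andP[BM sBA]; rewrite leqNgt; apply/negP => ltIB.
have [e /setDP[eB eI] eIM] := indep_augment IM BM ltIB.
have /maxI : P (e |: I).
  rewrite /P eIM subUset sub1set (subsetP sBA) // sIA !andbT.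
  exact: subset_trans sJI (subsetUr _ _).
by rewrite /= cardsU1 eI ltnn.
Qed.

Lemma rank_basis A :
  exists I, [/\ I \in indep M, I \subset A & #|I| = r A].
Proof.
have [I [_ IM sIA cI]] := indep_extend (complex0 (indep M)) (sub0set A).
by exists I.
Qed.

Lemma rank_indep I : I \in indep M -> r I = #|I|.
Proof.
move=> IM; apply/eqP; rewrite eqn_leq indep_leq_rank // andbT.
by apply/bigmax_leqP => B /andP[_]; apply: subset_leq_card.
Qed.

Lemma rankS A B : A \subset B -> r A <= r B.
Proof.
move=> sAB; have [I [IM sIA <-]] := rank_basis A.
exact: indep_leq_rank IM (subset_trans sIA sAB).
Qed.

Lemma rank_card_indep A : #|A| <= r A -> A \in indep M.
Proof.
have [I [IM sIA <-]] := rank_basis A => leAI.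
by have -> : A = I by apply/esym/eqP; rewrite eqEcard sIA.
Qed.

Lemma rankU1 e A : r (e |: A) <= (r A).+1.
Proof.
have [I [IM sIA <-]] := rank_basis (e |: A).
rewrite (cardsD1 e I) -add1n leq_add ?leq_b1 // indep_leq_rank //.
  exact: complexS (subsetDl _ _) IM.
by rewrite subDset.
Qed.

(** The matroid closure in terms of rank; [cl_flat], [sub_cl] and [cl_min] identify it as the
    smallest flat containing [A]. *)
Definition cl A : {set E} := [set e | r (e |: A) <= r A].

Lemma sub_cl A : A \subset cl A.
Proof. by apply/subsetP => e eA; rewrite inE setU1_id. Qed.

(** Extend a basis [J] of [A] to a basis [I] of [e |: B]. If [e] is in [I], it must already be in
    [J], since otherwise [e |: J] would be an independent subset of [e |: A] with more than [r A]
    elements. *)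
Lemma clS_rank e A B : A \subset B -> e \in cl A -> r (e |: B) <= r B.
Proof.
move=> sAB; rewrite inE => eA; have [J [JM sJA cJ]] := rank_basis A.
have sJeB : J \subset e |: B.
  exact: subset_trans sJA (subset_trans sAB (subsetUr _ _)).
have [I [sJI IM sIB <-]] := indep_extend JM sJeB.
case: (boolP (e \in I)) => eI; last first.
  rewrite indep_leq_rank //; apply/subsetP => x xI.
  have := subsetP sIB x xI; rewrite !inE => /predU1P[xe|//].
  by rewrite xe (negPf eI) in xI.
suff eJ : e \in J.
  by rewrite indep_leq_rank // -(setU1_id (subsetP sAB _ (subsetP sJA _ eJ))).
apply: contraTT eA => eJ; rewrite -ltnNge -cJ.
suff : #|e |: J| <= r (e |: A) by rewrite cardsU1 eJ.
apply: indep_leq_rank; last exact: setUS.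
by apply: complexS IM; rewrite subUset sub1set eI.
Qed.

(** A basis [J] of [A] is still a basis of [cl A]: a further element [e] of an extension would make
    [e |: J] independent, against [r (e |: A) <= r A]. *)
Lemma rank_cl A : r (cl A) = r A.
Proof.
have [J [JM sJA cJ]] := rank_basis A.
have [I [sJI IM sIA cI]] := indep_extend JM (subset_trans sJA (sub_cl A)).
suff sIJ : I \subset J.
  by rewrite -cI -cJ (_ : I = J) //; apply/eqP; rewrite eqEsubset sIJ.
apply/subsetP => e eI; apply/negP => /negP eJ.
have := subsetP sIA e eI; rewrite inE leqNgt -cJ => /negP[].
suff : #|e |: J| <= r (e |: A) by rewrite cardsU1 eJ.
apply: indep_leq_rank; last exact: setUS.
by apply: complexS IM; rewrite subUset sub1set eI.
Qed.

Lemma flatP F :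
  reflect (forall e, e \notin F -> r F < r (e |: F)) (flat M F).
Proof.
by apply: (iffP forallP) => h e; [move/implyP: (h e) | apply/implyP/h].
Qed.

Lemma cl_flat A : flat M (cl A).
Proof.
apply/flatP => e eA; rewrite rank_cl; have := eA; rewrite inE -ltnNge => lt_eA.
exact: leq_trans lt_eA (rankS (setUS _ (sub_cl A))).
Qed.

Lemma cl_min A F : A \subset F -> flat M F -> cl A \subset F.
Proof.
move=> sAF /flatP flF; apply/subsetP => e eA; apply/negP => /negP /flF.
by rewrite ltnNge (clS_rank sAF).
Qed.

Lemma flat_eq F A : flat M F -> F \subset A -> r A <= r F -> F = A.
Proof.
move=> /flatP flF sFA leAF; apply/eqP; rewrite eqEsubset sFA.
apply/subsetP => e eA; apply/negP => /negP /flF; rewrite ltnNge => /negP[].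
by apply: leq_trans leAF; rewrite rankS // subUset sub1set eA.
Qed.

Lemma cl_eq A F : A \subset F -> flat M F -> r F <= r A -> cl A = F.
Proof.
move=> sAF flF leFA; apply: flat_eq; rewrite ?rank_cl ?cl_min //.
exact: cl_flat.
Qed.

Lemma flat_setT : flat M setT.
Proof. by apply/flatP => e; rewrite inE. Qed.

Lemma flatI F G : flat M F -> flat M G -> flat M (F :&: G).
Proof.
move=> flF flG; apply/flatP => e; rewrite ltnNge; apply: contra => le_e.
have ecl : e \in cl (F :&: G) by rewrite inE.
rewrite inE (subsetP (cl_min (subsetIl F G) flF)) //.
exact: (subsetP (cl_min (subsetIr F G) flG)).
Qed.

(** Adding an element of [F] outside [cl A] raises the rank by exactly one; once the rank is [j],
    the closure is the required flat. *)
Lemma flat_between A F j : A \subset F -> flat M F -> r A <= j <= r F ->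
  exists G, [/\ flat M G, A \subset G, G \subset F & r G = j].
Proof.
move=> sAF flF; have [n] := ubnP (j - r A).
elim: n A sAF => // n IHn A sAF lt_n /andP[leAj lejF].
have [ltAj|] := ltnP (r A) j; last first.
  move=> lejA; exists (cl A); rewrite cl_flat sub_cl cl_min // rank_cl.
  by split=> //; apply/eqP; rewrite eqn_leq leAj.
have /subsetPn[e eF eA] : ~~ (F \subset cl A).
  by apply/negP => /rankS; rewrite rank_cl leqNgt (leq_trans ltAj).
have rA : r (e |: A) = (r A).+1.
  apply/eqP; rewrite eqn_leq rankU1 /=.
  by move: eA; rewrite inE -ltnNge.
have [||| G [flG sAG sGF rG]] := IHn (e |: A).
- by rewrite subUset sub1set eF.
- by rewrite rA subnS -ltnS prednK // subn_gt0.
- by rewrite rA ltAj.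
by exists G; split=> //; apply: subset_trans sAG; apply: subsetUr.
Qed.

(* Lexicographic basis exchange: the fundamental circuit of the least element
   in which the two bases differ must leave I, since I is independent. *)
Lemma lex_basis_exchange I J :
  I \in indep M -> J \in indep M -> cl I = cl J ->
  (set_key I < set_key J)%O ->
  exists i e, [/\ i \in J :\: I, e \notin J, e |: J :\ i \in indep M,
    e |: J :\ i \subset cl J & (set_key (e |: J :\ i) < set_key J)%O].
Proof.
move=> IM JM eqcl /set_key_ltP[e [eI eJ eqe]].
have sIJe : e |: I :&: J \subset e |: J by rewrite setUS ?subsetIr.
have IJM : e |: I :&: J \in indep M.
  by apply: complexS IM; rewrite subUset sub1set eI subsetIl.
(* A basis [B] of [e |: J] containing [e] and [I :&: J]. It has the size of [J], so it misses
   exactly one [i] of [J], and this [i] is not in [I]. *)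
have [B [sIB BM sBJ cB]] := indep_extend IJM sIJe.
have eclJ : e \in cl J by rewrite -eqcl (subsetP (sub_cl I)).
have cBJ : #|B| = #|J|.
  rewrite cB; apply/eqP; rewrite eqn_leq -(rank_indep JM).
  by rewrite (rankS (subsetUr _ _)) andbT; move: eclJ; rewrite inE.
have eB : e \in B by rewrite (subsetP sIB) // !inE eqxx.
have /subsetPn[i iJ iB] : ~~ (J \subset B).
  apply: contra eJ => sJB; suff -> : J = B by [].
  by apply/eqP; rewrite eqEcard sJB cBJ /=.
have iI : i \notin I.
  by apply: contra iB => iI; rewrite (subsetP sIB) // !inE iI iJ orbT.
have sBJi : B \subset e |: J :\ i.
  apply/subsetP => b bB; have := subsetP sBJ b bB; rewrite !inE.
  case/predU1P=> [->|bJ]; first by rewrite eqxx.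
  by rewrite bJ andbT; case: (eqVneq b i) bB iB => [-> ->|]; rewrite ?orbT.
have defB : B = e |: J :\ i.
  apply/eqP; rewrite eqEcard sBJi cardsU1 !inE (negPf eJ) andbF cBJ.
  by rewrite (cardsD1 i J) iJ /=.
exists i, e; rewrite -defB; split=> //; first by rewrite inE iI.
  by apply: subset_trans sBJ _; rewrite subUset sub1set eclJ sub_cl.
apply/set_key_ltP; exists e; split=> // b lt_be.
have neq_be : b != e by apply: contraTneq lt_be => ->; rewrite ltnn.
(* Below [e] the sets [I] and [J] agree, whereas [i] is only in [J]; so removing [i] changes nothing
   below [e]. *)
have neq_bi : b != i.
  by apply: contraNneq iI => eq_bi; rewrite -eq_bi eqe // eq_bi.
by rewrite defB !inE (negPf neq_be) neq_bi.
Qed.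

End Closure.

Lemma card_ord_geq n k : #|[set i : 'I_n | k <= i]| = n - k.
Proof.
transitivity (\sum_(k <= i < n) 1); last by rewrite sum_nat_const_nat muln1.
by rewrite big_geq_mkord -sum1_card; apply: eq_bigl => i; rewrite inE.
Qed.

(** * Facets of the augmented Bergman complex *)

Section Facets.
Variables (E : finType) (M : matroid E).
Local Notation r := (rank M).
Local Notation K := (augmented_bergman M).
Implicit Types (S T : {set aug_vertex M}) (F G : proper_flat M).

Lemma proper_flat_flat F : flat M F.
Proof. by case: F => F /= /andP[]. Qed.

Lemma proper_flat_rank F : r F < r setT.
Proof.
rewrite ltnNge; apply/negP => /(flat_eq (proper_flat_flat F) (subsetT F)).
by case: F => F /= /andP[_ /eqP].
Qed.

Lemma proper_flatP (A : {set E}) :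
  flat M A -> r A < r setT -> exists F, A = F.
Proof.
move=> flA ltA; have pA : flat M A && (A != setT).
  by rewrite flA; apply: contraTneq ltA => ->; rewrite ltnn.
by exists (ProperFlat pA).
Qed.

Lemma augP S :
  reflect [/\ y_part S \in indep M,
              {in x_part S &, forall F G, (F \subset G) || (G \subset F)} &
              {in x_part S, forall F, y_part S \subset F}]
          (S \in K).
Proof.
rewrite [S \in K]inE; apply: (iffP and3P) => -[yS xS yxS].
  split=> // [F G FS GS|]; last exact/forall_inP.
  move: xS; rewrite inE => /forall_inP/(_ F FS)/forall_inP/(_ G GS).
  by [].
split=> //; last exact/forall_inP.
rewrite inE; apply/forall_inP => F FS; apply/forall_inP => G GS; exact: xS.
Qed.

Lemma y_partE S e : (e \in y_part S) = (inl e \in S).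
Proof. by rewrite inE. Qed.

Lemma x_partE S F : (F \in x_part S) = (inr F \in S).
Proof. by rewrite inE. Qed.

Lemma part_inj S T : y_part S = y_part T -> x_part S = x_part T -> S = T.
Proof.
move=> eqy eqx; apply/setP => -[e|F]; first by rewrite -!y_partE eqy.
by rewrite -!x_partE eqx.
Qed.

Lemma card_part S : #|S| = #|y_part S| + #|x_part S|.
Proof.
rewrite -!sum1_card big_sumType /=.
by congr (_ + _); apply: eq_bigl => z; rewrite !inE.
Qed.

(* For a facet and #|y_part S| <= j <= rank M setT, the flat of rank j in the
   maximal chain of flats from the closure of y_part S to E: in particular
   level S (rank M setT) is E, an empty intersection. *)
Definition level S j : {set E} :=
  \bigcap_(F in x_part S | j <= r F) (F : {set E}).

Lemma level_sub S j F : F \in x_part S -> j <= r F -> level S j \subset F.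
Proof. by move=> FS jF; apply: bigcap_inf; rewrite FS. Qed.

Lemma sub_level S j (A : {set E}) :
  {in x_part S, forall F, j <= r F -> A \subset F} -> A \subset level S j.
Proof. by move=> sA; apply/bigcapsP => F /andP[FS]; apply: sA. Qed.

Lemma level_mono S i j : i <= j -> level S i \subset level S j.
Proof.
by move=> le_ij; apply: sub_level => F FS /(leq_trans le_ij); apply: level_sub.
Qed.

Lemma level_flat S j : flat M (level S j).
Proof.
rewrite /level; elim/big_ind: _ => [|A B|F _]; first exact: flat_setT.
  exact: flatI.
exact: proper_flat_flat.
Qed.

Section Simplex.
Variable S : {set aug_vertex M}.
Hypothesis SK : S \in K.

Lemma simplex_chain :
  {in x_part S &, forall F G, r F <= r G -> F \subset G}.
Proof.
have [_ ch _] := augP _ SK => F G FS GS leFG.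
case/orP: (ch F G FS GS) => // sGF.
by rewrite (flat_eq (proper_flat_flat G) sGF leFG).
Qed.

Lemma simplex_rank_inj : {in x_part S &, injective (fun F => r F)}.
Proof.
move=> F G FS GS eqr; apply/val_inj/eqP; rewrite eqEsubset.
by apply/andP; split; apply: simplex_chain; rewrite ?eqr.
Qed.

(** The intersection runs over a chain, hence equals its member of least rank when there is one. *)
Lemma levelP j :
  level S j = setT \/ exists F, [/\ F \in x_part S, level S j = F & j <= r F].
Proof.
have [F0 F0S|noF] := pickP [pred F | F \in x_part S & j <= r F]; last first.
  by left; rewrite /level big_pred0.
right; case: (arg_minnP (fun F => r F) F0S) => F /andP[FS jF] minF.
exists F; split=> //; apply/eqP; rewrite eqEsubset level_sub //.
apply: sub_level => G GS jG; apply: simplex_chain => //.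
by apply: minF; rewrite /= GS.
Qed.

Lemma y_sub_level j : y_part S \subset level S j.
Proof. by apply: sub_level => F FS _; have [_ _] := augP _ SK; apply. Qed.

Lemma leq_rank_level j : j <= r setT -> j <= r (level S j).
Proof. by case: (levelP j) => [->|[F [_ -> ]]]. Qed.

Lemma level_in F : F \in x_part S -> level S (r F) = F.
Proof.
move=> FS; apply: flat_eq; [exact: level_flat | exact: level_sub |].
exact/leq_rank_level/ltnW/proper_flat_rank.
Qed.

(** Converse of [level_in]: the levels determine the flats of a simplex. The empty intersection is
    excluded since [F] is proper. *)
Lemma level_part F : level S (r F) = F -> F \in x_part S.
Proof.
move=> lF; case: (levelP (r F)) => [|[G [GS eqG _]]].
  by rewrite lF => eF; have := proper_flat_rank F; rewrite eF ltnn.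
by have -> : F = G by apply/val_inj; rewrite -[LHS]lF.
Qed.

Lemma y_rank_leq F : F \in x_part S -> #|y_part S| <= r F.
Proof.
have [yM _ yF] := augP _ SK => FS.
by rewrite -(rank_indep yM) rankS ?yF.
Qed.

End Simplex.

Lemma facet_simplex S : S \in facets K -> S \in K.
Proof. by rewrite inE => /maxsetp. Qed.

Lemma setU1_simplex S H : S \in K -> y_part S \subset (H : proper_flat M) ->
  {in x_part S, forall F, (F \subset H) || (H \subset F)} ->
  inr H |: S \in K.
Proof.
case/augP=> yM ch yx sH chH; apply/augP.
have -> : y_part (inr H |: S) = y_part S by apply/setP => e; rewrite !inE.
have inx F : F \in x_part (inr H |: S) -> F = H \/ F \in x_part S.
  by rewrite !inE => /predU1P[[->]|]; [left|right].
split=> // [F G /inx[->|FS] /inx[->|GS]|F /inx[->//|/yx//]].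
- by rewrite subxx.
- by rewrite orbC chH.
- exact: chH.
exact: ch.
Qed.

(** If the flag skipped rank [j], a flat of rank [j] would fit between its neighbours and could be
    added as a vertex, against maximality. *)
Lemma facet_attains S j : S \in facets K -> #|y_part S| <= j < r setT ->
  exists2 F, F \in x_part S & r F = j.
Proof.
move=> Sfac /andP[leyj ltj]; have SK := facet_simplex Sfac.
have [yM ch yx] := augP _ SK.
have [F /andP[FS /eqP]|noF] := pickP [pred F | F \in x_part S & r F == j].
  by exists F.
(* [L] is the largest flat of [S] of rank below [j], or [y_part S] if there is none. *)
have [L [sL rL ltL leL]] : exists L : {set E}, [/\ y_part S \subset L, r L <= j,
    {in x_part S, forall F, r F < j -> F \subset L} & L \subset level S j].
  have [F0 F0S|noF0] := pickP [pred F | F \in x_part S & r F < j].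
    case: (arg_maxnP (fun F => r F) F0S) => F /andP[FS ltF] maxF.
    exists F; split; rewrite ?yx // ?(ltnW ltF) //.
      move=> G GS ltG; apply: (simplex_chain SK) => //.
      by apply: (maxF G); rewrite /= GS.
    apply: sub_level => G GS leG; apply: (simplex_chain SK) => //.
    exact: leq_trans (ltnW ltF) leG.
  exists (y_part S); split; rewrite ?rank_indep ?y_sub_level // => F FS ltF.
  by have := noF0 F; rewrite inE FS ltF.
have [|H [flH sLH sHU rH]] := flat_between leL (level_flat S j) (j := j).
  by rewrite rL leq_rank_level // ltnW.
have [|H' defH] := proper_flatP flH; first by rewrite rH.
move: sLH sHU rH; rewrite {H flH}defH => sLH sHU rH; exists H' => //.
have TK : inr H' |: S \in K.
  apply: setU1_simplex => //; first exact: subset_trans sLH.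
  move=> F FS; have [ltF|leF] := ltnP (r F) j.
    by rewrite (subset_trans (ltL F FS ltF)).
  by rewrite (subset_trans sHU) ?orbT ?level_sub.
move: Sfac; rewrite inE => /maxsetP[_ /(_ _ TK (subsetUr _ _))].
move=> /setP/(_ (inr H')).
by rewrite x_partE => <-; rewrite !inE eqxx.
Qed.

(** The rank maps the flats of a facet bijectively onto the integers from [#|y_part S|] to
    [r setT - 1]. *)
Lemma facet_card S : S \in facets K -> #|S| = r setT.
Proof.
move=> Sfac; have SK := facet_simplex Sfac; have [yM _ _] := augP _ SK.
have ley : #|y_part S| <= r setT by rewrite -(rank_indep yM) rankS ?subsetT.
rewrite card_part.
pose f F := Ordinal (proper_flat_rank F).
have injf : {in x_part S &, injective f}.
  by move=> F G FS GS /(congr1 val); apply: simplex_rank_inj SK _ _ FS GS.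
rewrite -(card_in_imset injf).
have -> : f @: x_part S = [set i : 'I_(r setT) | #|y_part S| <= i].
  apply/setP => i; rewrite inE; apply/imsetP/idP => [[F FS ->]|le_yi].
    exact: y_rank_leq.
  have [|F FS rF] := facet_attains Sfac (j := i).
    by rewrite le_yi ltn_ord.
  by exists F => //; apply: val_inj; rewrite /= rF.
by rewrite card_ord_geq subnKC.
Qed.

Lemma facet_y_leq S : S \in facets K -> #|y_part S| <= r setT.
Proof. by move/facet_card <-; rewrite card_part leq_addr. Qed.

Lemma facetP S : S \in K -> #|S| = r setT -> S \in facets K.
Proof.
move=> SK cS; have [T maxT sST] := @maxset_exists _ (mem K) S SK.
have Tfac : T \in facets K by rewrite inE.
suff -> : S = T by [].
by apply/eqP; rewrite eqEcard sST cS (facet_card Tfac) /=.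
Qed.

Lemma facet_swap S v w : S \in facets K -> v \in S -> w \notin S ->
  w |: S :\ v \in K -> w |: S :\ v \in facets K.
Proof.
move=> Sfac vS wS TK; apply: facetP => //; rewrite -(facet_card Sfac).
by rewrite cardsU1 !inE (negPf wS) andbF (cardsD1 v S) vS /=.
Qed.

Lemma level_rank S j : S \in facets K -> #|y_part S| <= j <= r setT ->
  r (level S j) = j.
Proof.
move=> Sfac /andP[leyj]; rewrite leq_eqVlt => /predU1P[eqj|ltj].
  apply/eqP; rewrite eqn_leq leq_rank_level ?facet_simplex ?eqj // andbT.
  by rewrite rankS ?subsetT.
have [|F FS rF] := facet_attains Sfac (j := j); first by rewrite leyj.
by rewrite -rF level_in ?facet_simplex.
Qed.

(** No flat of [S] has rank below [#|y_part S|], so all these levels coincide. Hence flags can be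
    compared from level 0 on, whatever the size of the independent set. *)
Lemma level_low S j : S \in facets K -> j <= #|y_part S| ->
  level S j = cl M (y_part S).
Proof.
move=> Sfac lejy; have SK := facet_simplex Sfac; have [yM _ _] := augP _ SK.
have -> : level S j = level S #|y_part S|.
  apply: eq_bigl => F; apply: andb_id2l => /(y_rank_leq SK) leF.
  by rewrite leF (leq_trans lejy).
apply/esym/cl_eq; [exact: y_sub_level | exact: level_flat |].
by rewrite level_rank ?leqnn ?facet_y_leq // rank_indep.
Qed.

Lemma facet_in S j : S \in facets K -> #|y_part S| <= j < r setT ->
  exists2 F, F \in x_part S & level S j = F.
Proof.
move=> Sfac /(facet_attains Sfac)[F FS <-]; exists F => //.
by rewrite level_in ?facet_simplex.
Qed.

Lemma facet_eq S T : S \in facets K -> T \in facets K ->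
  y_part S = y_part T -> (forall j, j < r setT -> level S j = level T j) ->
  S = T.
Proof.
move=> Sfac Tfac eqy eql; apply: part_inj => //.
apply/setP => F; have ltF := proper_flat_rank F.
have [SK TK] := (facet_simplex Sfac, facet_simplex Tfac).
apply/idP/idP => FS; apply: level_part => //.
  by rewrite -eql ?level_in.
by rewrite eql ?level_in.
Qed.

(** * Exchanging one vertex of a facet *)

Lemma partU1 S :
  ((forall e, y_part (inl e |: S) = e |: y_part S) *
   (forall e, x_part (inl e |: S) = x_part S) *
   (forall F, y_part (inr F |: S) = y_part S) *
   (forall F, x_part (inr F |: S) = F |: x_part S))%type.
Proof. by do !split; move=> z; apply/setP => w; rewrite !inE. Qed.

Lemma partD1 S :
  ((forall e, y_part (S :\ inl e) = y_part S :\ e) *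
   (forall e, x_part (S :\ inl e) = x_part S) *
   (forall F, y_part (S :\ inr F) = y_part S) *
   (forall F, x_part (S :\ inr F) = x_part S :\ F))%type.
Proof. by do !split; move=> z; apply/setP => w; rewrite !inE. Qed.

Lemma level_top S : level S (r setT) = setT.
Proof.
apply/eqP; rewrite -subTset; apply: sub_level => F _.
by rewrite leqNgt proper_flat_rank.
Qed.

(** The closure of [y_part T :\ i] has rank [#|y_part T| - 1], less than every flat of [T], and lies
    inside all of them: it is a new bottom for the flag. *)
Lemma drop_element T i : T \in facets K -> i \in y_part T ->
  exists U, [/\ U \in facets K, T :\ inl i \subset U &
                #|y_part U| < #|y_part T|].
Proof.
move=> Tfac iT; have TK := facet_simplex Tfac; have [yM _ yx] := augP _ TK.
have sD := subsetDl (y_part T) [set i].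
have rI : r (cl M (y_part T :\ i)) = #|y_part T :\ i|.
  by rewrite rank_cl rank_indep // (complexS sD).
have ltI : #|y_part T :\ i| < #|y_part T| by rewrite (cardsD1 i (y_part T)) iT.
have [|F defF] := proper_flatP (cl_flat M (y_part T :\ i)).
  by rewrite rI (leq_trans ltI) ?facet_y_leq.
have FT : inr F \notin T.
  rewrite -x_partE; apply/negP => /(y_rank_leq TK).
  by rewrite -defF rI leqNgt ltI.
exists (inr F |: T :\ inl i); split; last by rewrite partU1 partD1.
  apply: facet_swap => //; first by rewrite -y_partE.
  apply: setU1_simplex; rewrite ?partD1.
  - exact: complexS (subsetDl _ _) TK.
  - by rewrite -defF sub_cl.
  move=> G GT; rewrite -defF orbC cl_min ?proper_flat_flat //.
  exact: subset_trans sD (yx G GT).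
exact: subsetUr.
Qed.

(** Here [F] is the closure of [y_part T]. An element [e] of the next level outside [F] keeps
    [y_part T] independent and lies in all remaining flats, so it can replace [F]. *)
Lemma drop_bottom_flat T F :
  T \in facets K -> F \in x_part T -> r F = #|y_part T| ->
  exists U, [/\ U \in facets K, T :\ inr F \subset U &
                #|x_part U| < #|x_part T|].
Proof.
move=> Tfac FT rF; have TK := facet_simplex Tfac; have [yM ch yx] := augP _ TK.
have clF : cl M (y_part T) = F.
  by apply: cl_eq; rewrite ?yx ?proper_flat_flat // (rank_indep yM) rF.
(* When [F] is the last flat of [T], this level is the whole ground set. *)
have /subsetPn[e el eF] : ~~ (level T (r F).+1 \subset F).
  apply/negP => /(rankS M); rewrite level_rank ?ltnn //.
  by rewrite -rF leqnSn proper_flat_rank.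
have eT : e \notin y_part T by apply: contra eF; apply: subsetP; apply: yx.
exists (inl e |: T :\ inr F); split; last 1 first.
- by rewrite partU1 partD1 (cardsD1 F (x_part T)) FT.
- apply: facet_swap => //; [by rewrite -x_partE|by rewrite -y_partE|].
  apply/augP; rewrite !partU1 !partD1; split.
  + apply: rank_card_indep; rewrite cardsU1 eT -(rank_indep yM).
    by move: eF; rewrite -clF inE -ltnNge.
  + by move=> G H /setD1P[_ GT] /setD1P[_ HT]; apply: ch.
  move=> G /setD1P[neqGF GT]; rewrite subUset sub1set yx // andbT.
  apply: (subsetP (level_sub GT _) e el); rewrite ltn_neqAle rF y_rank_leq //.
  rewrite andbT -rF; apply: contra neqGF => /eqP eqr; apply/eqP.
  exact: (simplex_rank_inj TK).
exact: subsetUr.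
Qed.

(** The new basis stays in the closure of [y_part T], hence in every flat of [T], so the flag can be
    kept. *)
Lemma exchange_element S T : S \in facets K -> T \in facets K ->
  cl M (y_part S) = cl M (y_part T) ->
  (set_key (y_part S) < set_key (y_part T))%O ->
  exists v U, [/\ v \in T :\: S, U \in facets K, T :\ v \subset U,
    x_part U = x_part T & (set_key (y_part U) < set_key (y_part T))%O].
Proof.
move=> /facet_simplex/augP[SM _ _] Tfac eqcl.
have TK := facet_simplex Tfac; have [TM ch yx] := augP _ TK.
case/(lex_basis_exchange SM TM eqcl) => i [e [/setDP[iT iS] eT UM sU ltU]].
exists (inl i), (inl e |: T :\ inl i); rewrite !partU1 !partD1.
split=> //; last exact: subsetUr.
  by rewrite inE -!y_partE iS.
apply: facet_swap; rewrite -?y_partE //.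
apply/augP; rewrite !partU1 !partD1; split=> // F FT.
by apply: subset_trans sU _; rewrite cl_min ?yx ?proper_flat_flat.
Qed.

Definition level_lt S T : Prop :=
  exists2 m : 'I_(r setT),
    forall j, j < m -> level S j = level T j &
    (set_key (level S m) < set_key (level T m))%O.

(* The flags first differ at level n.+1 and meet again at level p.  The least
   element a of level T p :\: level T n is not in level T n.+1; at the level
   j.+1 just before a enters the flag of T, the flat is replaced by the closure
   of a and level T j. *)
Lemma exchange_flat S T : S \in facets K -> T \in facets K ->
  y_part S = y_part T -> level_lt S T ->
  exists v U, [/\ v \in T :\: S, U \in facets K, T :\ v \subset U,
    y_part U = y_part T & level_lt U T].
Proof.
move=> Sfac Tfac eqy [m eqm ltm].
have [SK TK] := (facet_simplex Sfac, facet_simplex Tfac).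
have [yM ch yx] := augP _ TK.
(* Up to level [#|y_part T|] both flags show the closure of the common independent set. *)
have ltym : #|y_part T| < m.
  rewrite ltnNge; apply: contraTN ltm => le_my.
  by rewrite !level_low ?eqy // ltxx.
case: m => -[|n] ltmr /= in eqm ltm ltym *; first by [].
have eqn := eqm n (ltnSn n).
have rT j : #|y_part T| <= j <= r setT -> r (level T j) = j.
  exact: level_rank.
have rS j : #|y_part T| <= j <= r setT -> r (level S j) = j.
  by rewrite -eqy; apply: level_rank.
(* [p] exists because both flags reach the ground set at level [r setT]. *)
have [p [ltnp lepr eqp neqp]] : exists p, [/\ n < p, p <= r setT,
    level S p = level T p &
    forall j, n < j < p -> level S j != level T j].
  pose P p := (n < p) && (level S p == level T p).
  have topP : P (r setT).
    rewrite /P (ltnW ltmr) /=; apply/eqP.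
    by rewrite !level_top.
  case: (ex_minnP (ex_intro P _ topP)) => p /andP[ltnp /eqP eqp] minp.
  exists p; split=> //.
    exact: minp topP.
  move=> j /andP[ltnj ltjp]; apply: contraTneq ltjp => eqj; rewrite -leqNgt.
  by rewrite minp // /P ltnj eqj eqxx.
have [e [eS eT eqe]] := set_key_ltP _ _ ltm.
have ep : e \in level T p by rewrite -eqp; apply: subsetP eS; apply: level_mono.
have eLn : e \notin level T n.
  by apply: contra eT; apply: subsetP; apply: level_mono.
have eD : e \in level T p :\: level T n by rewrite inE eLn.
case: (arg_minnP (fun a => enum_rank a : nat) eD) => a /setDP[aTp aTn] mina.
(* Otherwise [a] would differ from [e] and precede it, hence lie in both levels [n.+1]; each would
   then be the closure of [a] and the common level [n]. *)
have aT : a \notin level T n.+1.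
  apply/negP => aT1.
  have aS1 : a \in level S n.+1.
    rewrite eqe //; rewrite ltn_neqAle mina // andbT.
    by apply: contraNneq eT => /val_inj/enum_rank_inj <-.
  have rU : (r (level T n)).+1 <= r (a |: level T n).
    by have /flatP := level_flat T n; apply.
  rewrite rT in rU; last by rewrite -ltnS ltym (ltnW (ltnW ltmr)).
  have clU : cl M (a |: level T n) = level T n.+1.
    apply: cl_eq; rewrite ?level_flat // ?rT ?(ltnW ltym) ?(ltnW ltmr) //.
    by rewrite subUset sub1set aT1 level_mono.
  suff eqST : level S n.+1 = level T n.+1 by rewrite eqST (negPf eT) in eS.
  rewrite -clU; apply/esym/cl_eq;
    rewrite ?level_flat ?rS ?(ltnW ltym) ?(ltnW ltmr) //.
  by rewrite subUset sub1set aS1 -eqn level_mono.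
have [j [ltnj ltjp aTj aTj1]] : exists j, [/\ n < j, j < p,
    a \notin level T j & a \in level T j.+1].
  case: (ex_minnP (ex_intro (fun q => a \in level T q) p aTp)) => -[|j] aq minq.
    by case/negP: aTn; apply: subsetP aq; apply: level_mono.
  exists j; split=> //.
  - rewrite ltnNge; apply: contra aT => lejn; apply: subsetP aq.
    exact: level_mono.
  - exact: minq.
  by apply/negP => /minq; rewrite ltnn.
(* Shift the index: [G], the flat of [T] of rank [j.+1], is the last one avoiding [a], and [H] of
   the same rank will fit between levels [j] and [j.+2]. *)
case: j => // j in ltnj ltjp aTj aTj1 *.
have lejr : j.+1 < r setT := leq_trans ltjp lepr.
have leyj : #|y_part T| <= j := leq_trans ltym ltnj.
have rng : #|y_part T| <= j.+1 < r setT by rewrite lejr leqW.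
have [G GT defG] := facet_in Tfac rng.
have rG : r G = j.+1 by rewrite -defG rT // leqW // ltnW.
pose A := a |: level T j.
have aTj0 : a \notin level T j.
  by apply: contra aTj; apply: subsetP; apply: level_mono.
have rA : r A = j.+1.
  have rTj : r (level T j) = j by rewrite rT // leyj ltnW // ltnW.
  apply/eqP; rewrite eqn_leq -{1}rTj rankU1 /= -{1}rTj.
  by have /flatP := level_flat T j; apply.
have [|H defH] := proper_flatP (cl_flat M A); first by rewrite rank_cl rA.
have rH : r H = j.+1 by rewrite -defH rank_cl.
have aH : a \in (H : {set E}) by rewrite -defH (subsetP (sub_cl M A)) // setU11.
have sjH : level T j \subset H.
  by rewrite -defH (subset_trans _ (sub_cl M A)) ?subsetUr.
have sHj : H \subset level T j.+2.
  rewrite -defH cl_min ?level_flat // subUset sub1set aTj1.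
  by rewrite level_mono // leqW.
have HT : inr H \notin T.
  rewrite -x_partE; apply: contra aTj => HT; rewrite defG.
  by have <- : H = G by apply: (simplex_rank_inj TK); rewrite ?rH.
pose U := inr H |: T :\ inr G.
have xTU F : F \in x_part T -> r F <= j -> F \in x_part U.
  rewrite partU1 partD1 => FT leF; rewrite !inE -x_partE FT andbT.
  by apply/orP; right; apply: contraTneq leF => ->; rewrite rG ltnn.
have UK : U \in K.
  apply: setU1_simplex; rewrite ?partD1.
  - exact: complexS (subsetDl _ _) TK.
  - exact: subset_trans (y_sub_level TK j) sjH.
  move=> F /setD1P[neqFG FT].
  have [leFj|ltjF] := leqP (r F) j.
    apply/orP; left; apply: subset_trans sjH.
    by rewrite -(level_in TK FT) level_mono.
  apply/orP; right; apply: subset_trans sHj _; apply: level_sub => //.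
  rewrite ltn_neqAle ltjF andbT; apply: contra neqFG => /eqP eqr; apply/eqP.
  by apply: (simplex_rank_inj TK); rewrite ?rG.
have yU : y_part U = y_part T by rewrite partU1 partD1.
have Ufac : U \in facets K by apply: facet_swap => //; rewrite -x_partE.
exists (inr G), U; split=> //; last 1 first.
- exists (Ordinal lejr) => [i /= ltij|/=].
    have [lei|lti] := leqP i #|y_part T|.
      by rewrite !level_low ?yU.
    have [|F FT defF] := facet_in Tfac (j := i).
      by rewrite ltnW // (ltn_trans ltij).
    have rF : r F = i by rewrite -defF rT // ltnW // ltnW // (ltn_trans ltij).
    by rewrite defF -rF level_in // xTU ?rF.
  have -> : level U j.+1 = H.
    by rewrite -rH level_in // !inE eqxx.
  apply/set_key_ltP; exists a; split=> // b ltba.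
  have sHp : H \subset level T p by rewrite (subset_trans sHj) ?level_mono.
  have snH : level T n \subset H by rewrite (subset_trans _ sjH) ?level_mono.
  have bD : b \notin level T p :\: level T n.
    by apply/negP => /mina; rewrite leqNgt ltba.
  (* By minimality of [a], no element before [a] enters between levels [n] and [p]; so [H] and [G]
     agree before [a], which only [H] contains. *)
  have between (B : {set E}) : level T n \subset B -> B \subset level T p ->
      (b \in B) = (b \in level T n).
    move=> /subsetP snB /subsetP sBp; apply/idP/idP => [/sBp bp|/snB //].
    by move: bD; rewrite inE bp andbT negbK.
  rewrite !between // level_mono //; exact: ltnW.
(* The flags differ at every level strictly between [n] and [p], in particular at [j.+1], so [G] is
   not a flat of [S]. *)
- rewrite inE -!x_partE GT andbT; apply/negP => GS.
  have /negP[] := neqp _ (introT andP (conj ltnj ltjp)); apply/eqP.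
  by rewrite defG -rG level_in.
exact: subsetUr.
Qed.

End Facets.

(** * The two shellings *)

Section FacetOrder.
Variables (E : finType) (M : matroid E).
Local Notation r := (rank M).
Local Notation K := (augmented_bergman M).
Implicit Types (S T : {set aug_vertex M}) (F G : proper_flat M).

(** [k] will be [#|y_part S|] for (i) and [#|x_part S|] for (ii); on facets the two have constant
    sum, so the second choice reverses the comparison of sizes. *)
Definition facet_key (k : {set aug_vertex M} -> nat) S :
    nat *l (#|E|.-tuplelexi bool *l
            (r setT).-tuplelexi (#|E|.-tuplelexi bool)) :=
  (k S, (set_key (y_part S), [tuple set_key (level S j) | j < r setT])).

Definition facet_lt k : rel {set aug_vertex M} :=
  fun S T => (facet_key k S < facet_key k T)%O.

Lemma facet_ltP k S T :
  facet_lt k S T <->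
  [\/ k S < k T,
      k S = k T /\ (set_key (y_part S) < set_key (y_part T))%O |
      [/\ k S = k T, y_part S = y_part T & level_lt S T]].
Proof.
rewrite /facet_lt !lexi_pair_lt /= ltEnat /= -/(_ < _).
have tupleP : reflect (level_lt S T)
    ([tuple set_key (level S j) | j < r setT] <
     [tuple set_key (level T j) | j < r setT] :> _.-tuplelexi _)%O.
  apply: (iffP ltxi_tuplePlt) => -[m eqm ltm]; exists m.
  - move=> j ltjm; have := eqm (Ordinal (ltn_trans ltjm (ltn_ord m))) ltjm.
    by rewrite !tnth_mktuple => /set_key_inj.
  - by rewrite !tnth_mktuple in ltm.
  - by move=> j ltjm; rewrite !tnth_mktuple eqm.
  by rewrite !tnth_mktuple.
split.
  case/orP=> [ltk|/andP[/eqP eqk]]; first by constructor 1.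
  case/orP=> [lty|/andP[/eqP/set_key_inj eqy /tupleP ltl]].
    by constructor 2.
  by constructor 3.
case=> [->//|[-> ->]|[-> -> /tupleP ltl]]; rewrite eqxx ?orbT //.
by rewrite ltl eqxx !orbT.
Qed.

Lemma pure_augmented_bergman : pure K.
Proof. by move=> S T SK TK; rewrite !facet_card. Qed.

Lemma facet_lt_total k : strict_total_order_on (facets K) (facet_lt k).
Proof.
split=> [S _|S T U _ _ _|S T Sfac Tfac neqST]; rewrite /facet_lt.
- exact: ltxx.
- exact: lt_trans.
rewrite -neq_lt; apply: contra neqST => /eqP eqk; apply/eqP/facet_eq => //.
  exact: set_key_inj (congr1 (fun z => z.2.1) eqk).
move=> j ltj; apply: set_key_inj.
have := congr1 (fun z => tnth z.2.2 (Ordinal ltj)) eqk.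
by rewrite !tnth_mktuple.
Qed.

Lemma y_first_shelling : is_shelling K (facet_lt (fun S => #|y_part S|)).
Proof.
apply: exchange_shelling => [||S T Sfac Tfac /facet_ltP ltST].
- exact: pure_augmented_bergman.
- exact: facet_lt_total.
have [sTS|/subsetPn[i iT iS]] := boolP (y_part T \subset y_part S); last first.
  have [U [Ufac sTU ltU]] := drop_element Tfac iT.
  exists (inl i), U; rewrite inE -!y_partE iS iT; split=> //.
  by apply/facet_ltP; constructor 1.
(* Since [S] comes before [T], this inclusion forces equal independent sets, leaving only the flags
   to compare. *)
have leTS := subset_leq_card sTS.
have eqy : #|y_part S| <= #|y_part T| -> y_part S = y_part T.
  by move=> leST; apply/esym/eqP; rewrite eqEcard sTS.
case: ltST => [|[eqc]|[_ eqST ltl]].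
- by rewrite ltnNge leTS.
- by rewrite eqy ?eqc ?leqnn // ltxx.
have [v [U [vT Ufac sTU eqU ltU]]] := exchange_flat Sfac Tfac eqST ltl.
by exists v, U; split=> //; apply/facet_ltP; constructor 3; rewrite eqU.
Qed.

Lemma x_first_shelling : is_shelling K (facet_lt (fun S => #|x_part S|)).
Proof.
apply: exchange_shelling => [||S T Sfac Tfac ltST].
- exact: pure_augmented_bergman.
- exact: facet_lt_total.
have [SK TK] := (facet_simplex Sfac, facet_simplex Tfac).
have lexST : #|x_part S| <= #|x_part T|.
  by case/facet_ltP: ltST => [/ltnW|[-> _]|[-> _ _]].
have leyTS : #|y_part T| <= #|y_part S|.
  have := facet_card Sfac; rewrite -(facet_card Tfac) !card_part => eqc.
  by rewrite -(leq_add2r #|x_part T|) -eqc leq_add2l.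
have [SM _ yxS] := augP _ SK; have [TM _ yxT] := augP _ TK.
pose B := level T #|y_part T|.
have rB : r B = #|y_part T| by rewrite /B level_rank ?leqnn ?facet_y_leq.
have clT : cl M (y_part T) = B by rewrite /B level_low.
have [sSB|nsSB] := boolP (y_part S \subset B); last first.
  have ltr : #|y_part T| < r setT.
    (* If [y_part T] had full rank, [B] would be the ground set and contain [y_part S]. So [B] is a
       proper flat of [T]. *)
    rewrite ltn_neqAle facet_y_leq // andbT; apply: contra nsSB => /eqP eqr.
    by rewrite /B eqr level_top subsetT.
  have [|F FT defF] := facet_in Tfac (j := #|y_part T|); first by rewrite leqnn.
  have [|U [Ufac sTU ltU]] := drop_bottom_flat Tfac FT; first by rewrite -defF.
  exists (inr F), U; split=> //; last by apply/facet_ltP; constructor 1.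
  rewrite inE -!x_partE FT andbT; apply: contra nsSB => FS.
  by rewrite /B defF yxS.
(* An independent subset of [B] with at least [r B] elements spans [B]. *)
have clS : cl M (y_part S) = B.
  by apply: cl_eq; rewrite ?level_flat // rB rank_indep.
have eqcl : cl M (y_part S) = cl M (y_part T) by rewrite clS.
have eqx : #|x_part S| = #|x_part T|.
  have eqy : #|y_part S| = #|y_part T|.
    by rewrite -(rank_indep SM) -rank_cl clS rB.
  apply/eqP; rewrite -(eqn_add2l #|y_part T|) -{1}eqy -!card_part.
  by rewrite !facet_card.
case/facet_ltP: ltST => [|[_ lty]|[_ eqy ltl]]; first by rewrite eqx ltnn.
  have [v [U [vT Ufac sTU eqU ltU]]] := exchange_element Sfac Tfac eqcl lty.
  by exists v, U; split=> //; apply/facet_ltP; constructor 2; rewrite eqU.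
have [v [U [vT Ufac sTU eqU ltU]]] := exchange_flat Sfac Tfac eqy ltl.
exists v, U; split=> //; apply/facet_ltP; constructor 3; split=> //.
apply/eqP; rewrite -(eqn_add2l #|y_part T|) -{1}eqU -!card_part.
by rewrite !facet_card.
Qed.

(** * Facets of the two subcomplexes *)

Lemma cone_facetE S :
  (S \in facets (aug_cone M)) = (S \in facets K) && (y_part S == set0).
Proof.
apply/idP/andP => [|[Sfac y0]]; rewrite [_ \in _]inE.
  case/maxsetP; rewrite inE aug_coneE => /andP[SK y0] maxS.
  (* Among the facets of [K] containing [S], take one with the fewest elements of [E]: any left over
     could be traded for a flat by [drop_element] without leaving the facets over [S]. *)
  have [U0 maxU0 sSU0] := @maxset_exists _ (mem K) S SK.
  pose P U := (U \in facets K) && (S \subset U).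
  have PU0 : P U0 by rewrite /P inE maxU0.
  case: (@arg_minnP _ U0 P (fun U => #|y_part U|) PU0) => U.
  move=> /andP[Ufac sSU] minU; suff yU : y_part U == set0.
    suff <- : U = S by [].
    by apply: maxS sSU; rewrite inE aug_coneE facet_simplex.
  apply/set0Pn => -[i iU].
  have [W [Wfac sUW]] := drop_element Ufac iU.
  rewrite ltnNge minU // /P Wfac (subset_trans _ sUW) // subsetD1 sSU -y_partE.
  by rewrite (eqP y0) inE.
apply/maxsetP; split=> [|T]; rewrite inE aug_coneE; last first.
  by move=> /andP[TK _]; move: Sfac; rewrite inE => /maxsetP[_]; apply.
by rewrite facet_simplex.
Qed.

(** Dually, a facet over [S] with the fewest flats has none: otherwise [facet_attains] supplies its
    bottom flat, which [drop_bottom_flat] trades for an element. *)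
Lemma indep_facetE S :
  (S \in facets (aug_indep M)) = (S \in facets K) && (x_part S == set0).
Proof.
apply/idP/andP => [|[Sfac x0]]; rewrite [_ \in _]inE.
  case/maxsetP; rewrite inE aug_indepE => /andP[SK x0] maxS.
  have [U0 maxU0 sSU0] := @maxset_exists _ (mem K) S SK.
  pose P U := (U \in facets K) && (S \subset U).
  have PU0 : P U0 by rewrite /P inE maxU0.
  case: (@arg_minnP _ U0 P (fun U => #|x_part U|) PU0) => U.
  move=> /andP[Ufac sSU] minU; suff xU : x_part U == set0.
    suff <- : U = S by [].
    by apply: maxS sSU; rewrite inE aug_indepE facet_simplex.
  rewrite -cards_eq0 -leqn0 leqNgt; apply/negP => xU.
  have [|F FU rF] := facet_attains Ufac (j := #|y_part U|).
    by rewrite leqnn -(facet_card Ufac) card_part -addn1 leq_add2l.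
  have [W [Wfac sUW]] := drop_bottom_flat Ufac FU rF.
  rewrite ltnNge minU // /P Wfac (subset_trans _ sUW) // subsetD1 sSU -x_partE.
  by rewrite (eqP x0) inE.
apply/maxsetP; split=> [|T]; rewrite inE aug_indepE; last first.
  by move=> /andP[TK _]; move: Sfac; rewrite inE => /maxsetP[_]; apply.
by rewrite facet_simplex.
Qed.

End FacetOrder.

Theorem theorem1p1 (E : finType) (M : matroid E) :
  [/\ shellable (augmented_bergman M),
      exists lt : rel {set aug_vertex M},
        [/\ is_shelling (augmented_bergman M) lt,
            facets_first (augmented_bergman M) (aug_cone M) lt &
            facets_last (augmented_bergman M) (aug_indep M) lt] &
      exists lt : rel {set aug_vertex M},
        [/\ is_shelling (augmented_bergman M) lt,
            facets_first (augmented_bergman M) (aug_indep M) lt &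
            facets_last (augmented_bergman M) (aug_cone M) lt]].
Proof.
have card0 (S T : {set aug_vertex M}) :
    S \in facets (augmented_bergman M) -> T \in facets (augmented_bergman M) ->
    #|y_part S| + #|x_part S| = #|y_part T| + #|x_part T|.
  by move=> Sfac Tfac; rewrite -!card_part !facet_card.
split.
- by exists (facet_lt (fun S => #|y_part S|)); apply: y_first_shelling.
- exists (facet_lt (fun S => #|y_part S|)).
  split; first exact: y_first_shelling.
    move=> S T; rewrite in_setD !cone_facetE => /andP[_ /eqP yS] /andP[yT Tfac].
    apply/facet_ltP; constructor 1; rewrite yS cards0 card_gt0.
    by move: yT; rewrite Tfac.
  move=> S T; rewrite in_setD !indep_facetE.
  move=> /andP[xS Sfac] /andP[Tfac /eqP xT].
  (* All facets have the same size, so having no flats means having the largest independent set. *)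
  apply/facet_ltP; constructor 1; move: (card0 S T Sfac Tfac) xS.
  rewrite Sfac /= xT cards0 addn0 -card_gt0 => <- xS_gt0.
  by rewrite -[ltnLHS]addn0 ltn_add2l.
exists (facet_lt (fun S => #|x_part S|)); split; first exact: x_first_shelling.
  move=> S T; rewrite in_setD !indep_facetE => /andP[_ /eqP xS] /andP[xT Tfac].
  apply/facet_ltP; constructor 1; rewrite xS cards0 card_gt0.
  by move: xT; rewrite Tfac.
move=> S T; rewrite in_setD !cone_facetE => /andP[yS Sfac] /andP[Tfac /eqP yT].
apply/facet_ltP; constructor 1; move: (card0 S T Sfac Tfac) yS.
rewrite Sfac /= yT cards0 add0n -card_gt0 => <- yS_gt0.
by rewrite -[ltnLHS]add0n ltn_add2r.
Qed.
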